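(* $\mathbb{Q}_0^{ia}\cong I\bigl(\Sigma_{iamdz},\,E_{iamdz}\cup\{(x\cdot(x+y))\cdot(x\cdot(x+y))^{-1}=x\cdot x^{-1}\}\bigr)$, where $\mathbb{Q}_0^{ia}=I\bigl(\Sigma_{iamdz},\,E_{iamdz}\cup\{(1+x^2+y^2)\cdot(1+x^2+y^2)^{-1}=1\}\bigr)$.
   Context: The signature $\Sigma_{iamdz}$ of inversive arithmetical meadows with zero has the constants $0,1$, the binary operators $+$ and $\cdot$, and the unary operator ${}^{-1}$ (no additive inverse). $E_{iamdz}$ is the set of equations $(x+y)+z=x+(y+z)$, $x+y=y+x$, $x+0=x$, $(x\cdot y)\cdot z=x\cdot(y\cdot z)$, $x\cdot y=y\cdot x$, $x\cdot 1=x$, $x\cdot(y+z)=x\cdot y+x\cdot z$, $(x^{-1})^{-1}=x$, $x\cdot(x\cdot x^{-1})=x$. $I(\Sigma,E)$ denotes the initial algebra (unique up to isomorphism) among the algebras over the signature $\Sigma$ that satisfy the equations $E$, and $\cong$ denotes isomorphism of $\Sigma_{iamdz}$-algebras. Here $p^0=1$ and $p^{n+1}=p^n\cdot p$ for natural number exponents. $\mathbb{Q}_0^{ia}$ is called the inversive arithmetical meadow of rational numbers with zero. *)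

(* Defs.v *)
(* MathComp world. *)
From mathcomp Require Import all_boot.
From mathcomp Require Import boolp classical_sets.

Set Implicit Arguments.
Unset Strict Implicit.
Unset Printing Implicit Defensive.

Local Open Scope classical_set_scope.

Inductive term : Type :=
  | Var of nat
  | Zero
  | One
  | Add of term & term
  | Mul of term & term
  | Inv of term.

Record equation : Type := Equation { lhs : term; rhs : term }.

Declare Scope term_scope.
Delimit Scope term_scope with term.
Bind Scope term_scope with term.

Notation "0" := Zero : term_scope.
Notation "1" := One : term_scope.
Notation "s + t" := (Add s t) : term_scope.
Notation "s * t" := (Mul s t) : term_scope.
Notation "t ^-1" := (Inv t) : term_scope.
Notation "s ≈ t" := (Equation s%term t%term) (at level 70, no associativity).

Fixpoint tpow (p : term) (n : nat) : term :=
  if n is m.+1 then Mul (tpow p m) p else One.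

Notation "p ^ n" := (tpow p n%N) : term_scope.

Definition x : term := Var 0.
Definition y : term := Var 1.
Definition z : term := Var 2.

Definition E_iamdz : set equation :=
  [set (x + y) + z ≈ x + (y + z);
       x + y ≈ y + x;
       x + 0 ≈ x;
       (x * y) * z ≈ x * (y * z);
       x * y ≈ y * x;
       x * 1 ≈ x;
       x * (y + z) ≈ x * y + x * z;
       (x^-1)^-1 ≈ x;
       x * (x * x^-1) ≈ x].

Record algebra : Type := Algebra {
  carrier :> Type;
  azero : carrier;
  aone : carrier;
  aadd : carrier -> carrier -> carrier;
  amul : carrier -> carrier -> carrier;
  ainv : carrier -> carrier
}.

Fixpoint eval (A : algebra) (env : nat -> A) (t : term) : A :=
  match t with
  | Var n => env n
  | Zero => azero A
  | One => aone A
  | Add s t => aadd (eval env s) (eval env t)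
  | Mul s t => amul (eval env s) (eval env t)
  | Inv s => ainv (eval env s)
  end.

Definition satisfies (A : algebra) (E : set equation) : Prop :=
  forall e, E e -> forall env : nat -> A, eval env (lhs e) = eval env (rhs e).

Definition homomorphism (A B : algebra) (f : A -> B) : Prop :=
  [/\ f (azero A) = azero B,
      f (aone A) = aone B,
      {morph f : a b / aadd a b >-> aadd a b},
      {morph f : a b / amul a b >-> amul a b} &
      {morph f : a / ainv a >-> ainv a}].

Definition isomorphic (A B : algebra) : Prop :=
  exists2 f : A -> B, homomorphism f & bijective f.

Definition is_initial (E : set equation) (A : algebra) : Prop :=
  satisfies A E /\
  forall B : algebra, satisfies B E ->
    exists2 f : A -> B, homomorphism f &
      forall g : A -> B, homomorphism g -> g =1 f.

(* Initial algebras exist for every set of equations, so a statement about all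
   algebras satisfying [is_initial E] is never vacuous. The witness is the
   quotient of the terms, with variables read as 0, by equality in all models
   of E, carried by a choice of representatives. *)
Section Existence.
Variable E : set equation.

Definition teq (s t : term) : Prop :=
  forall A : algebra, satisfies A E ->
    eval (fun=> azero A) s = eval (fun=> azero A) t.

Lemma teq_refl t : exists s, teq t s. Proof. by exists t. Qed.

Definition canon (t : term) : term := sval (cid (teq_refl t)).

Lemma canonP t : teq t (canon t).
Proof. exact: svalP (cid (teq_refl t)). Qed.

Lemma canon_eq s t : teq s t -> canon s = canon t.
Proof.
move=> st; rewrite /canon.
suff: teq s = teq t.
  by move: (teq_refl s) (teq_refl t) => + + e; rewrite e => h1 h2;
     rewrite (Prop_irrelevance h1 h2).
apply/funext => r; apply/propext; split=> h A AE; last by rewrite (st A AE) (h A AE).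
by rewrite -(st A AE) (h A AE).
Qed.

Lemma canonK t : canon (canon t) = canon t.
Proof. by apply: canon_eq => A AE; rewrite -(canonP t AE). Qed.

Definition tquot : Type := {t : term | canon t = t}.
Definition tpi (t : term) : tquot := exist _ (canon t) (canonK t).

Definition talgebra : algebra :=
  @Algebra tquot (tpi Zero) (tpi One)
    (fun a b => tpi (Add (sval a) (sval b)))
    (fun a b => tpi (Mul (sval a) (sval b)))
    (fun a => tpi (Inv (sval a))).

Lemma tpi_sval (a : tquot) : tpi (sval a) = a.
Proof. by case: a => t ht; exact: eq_exist. Qed.

Lemma tpi_eq s t : teq s t -> tpi s = tpi t.
Proof. by move=> /canon_eq st; exact: eq_exist. Qed.

Definition tval (B : algebra) (a : tquot) : B := eval (fun=> azero B) (sval a).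

Lemma tval_pi (B : algebra) (t : term) : satisfies B E ->
  tval B (tpi t) = eval (fun=> azero B) t.
Proof. by move=> BE; rewrite /tval /= -(canonP t BE). Qed.

Lemma tval_hom (B : algebra) : satisfies B E ->
  @homomorphism talgebra B (tval B).
Proof. by move=> BE; split=> [||a b|a b|a] /=; rewrite tval_pi. Qed.

Lemma hom_eval (A B : algebra) (f : A -> B) (env : nat -> A) (t : term) :
  homomorphism f -> f (eval env t) = eval (f \o env) t.
Proof.
case=> f0 f1 fD fM fV.
by elim: t => //= [s IHs t IHt|s IHs t IHt|s IHs];
   rewrite ?fD ?fM ?fV ?IHs ?IHt.
Qed.

Lemma tval_inj (a b : tquot) :
  (forall B, satisfies B E -> tval B a = tval B b) -> a = b.
Proof. by move=> ab; rewrite -(tpi_sval a) -(tpi_sval b); exact: tpi_eq. Qed.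

Lemma eval_tpi (t : term) : eval (fun=> azero talgebra) t = tpi t.
Proof.
apply: tval_inj => B BE.
rewrite (hom_eval _ _ (tval_hom BE)) tval_pi //.
by congr eval; apply/funext => n /=; rewrite tval_pi.
Qed.

Lemma talgebra_initial : is_initial E talgebra.
Proof.
split=> [e Ee env|B BE].
  apply: tval_inj => B BE.
  by rewrite !(hom_eval _ _ (tval_hom BE)); exact: BE.
exists (tval B) => [|g gh a]; first exact: tval_hom.
rewrite -[in LHS](tpi_sval a) -eval_tpi hom_eval // /tval.
by congr eval; apply/funext => n /=; case: gh.
Qed.

End Existence.

Theorem initial_exists (E : set equation) : exists A, is_initial E A.
Proof. by exists (talgebra E); exact: talgebra_initial. Qed.

(* Main.v *)
From mathcomp Require Import all_boot all_order all_algebra zify.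
From mathcomp Require Import boolp classical_sets.
Require Import Defs.

(** Both initial algebras are isomorphic because each of them maps
    homomorphically to the other through the nonnegative rationals, and
    endomorphisms of an initial algebra are trivial. The nonnegative rationals
    satisfy both equations. Conversely, they map to any model of [E_iamdz] in
    which all positive numerals are invertible, by sending [a / b] to
    [a * b^-1]. The second equation at [x = 1] says that all [1 + y] are
    invertible. The first equation makes [1 + a^2 + b^2] invertible, hence
    also all its divisors; every prime divides some number of that form, so
    every positive numeral is a product of invertible elements. *)

Set Implicit Arguments.
Unset Strict Implicit.
Unset Printing Implicit Defensive.

Import Order.TTheory GRing.Theory Num.Theory.

Local Open Scope classical_set_scope.

(** * Prime divisors of sums 1 + a^2 + b^2 *)

(* Pigeonhole: modulo an odd prime p, a^2 and -1 - b^2 each take (p + 1)/2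
   distinct values for a, b <= p/2, hence share a value. *)
Lemma prime_dvdn_1_sqr_sqr (p : nat) :
  prime p -> exists a b : nat, p %| (1 + a ^ 2 + b ^ 2)%N.
Proof.
move=> p_pr.
have [->|odd_p] := even_prime p_pr; first by exists 1%N, 0%N.
have p_gt2 := odd_prime_gt2 odd_p p_pr.
pose f (i : 'I_(p./2.+1)) : 'F_p := (i%:R ^+ 2)%R.
have f_inj : injective f.
  move=> i j /eqP; rewrite eqf_sqr => /orP[] /eqP ij; apply: val_inj => /=.
    move/(congr1 val): ij; rewrite /= !val_Fp_nat //.
    by rewrite !modn_small //; have := ltn_ord i; have := ltn_ord j; lia.
  (* Both indices are at most (p - 1)/2, so i + j < p and divisibility by p forces i = j = 0. *)
  have : (p %| i + j)%N.
    rewrite /dvdn -(val_Fp_nat p_pr) natrD ij addNr; exact/eqP.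
  have [ij0 _|ij_gt0 /dvdn_leq-/(_ ij_gt0)] := posnP (i + j); first by lia.
  by have := ltn_ord i; have := ltn_ord j; lia.
pose g (i : 'I_(p./2.+1)) : 'F_p := (- 1 - i%:R ^+ 2)%R.
have g_inj : injective g by move=> i j /addrI /oppr_inj /f_inj.
have [/exists_inP [u]|] := boolP [exists u in codom f, u \in codom g].
  move=> /codomP[a ->] /codomP[b fg]; exists a, b.
  rewrite /dvdn -(val_Fp_nat p_pr) !natrD !natrX.
  by rewrite -/(f a) fg /g addrA subrK subrr.
move=> /exists_inPn dis.
have : (#|codom f| + #|codom g| <= #|'F_p|)%N.
  rewrite -cardUI -[X in (_ + X)%N]/(#|_|).
  rewrite [X in (_ + X)%N]eq_card0 ?addn0 ?max_card // => u.
  by rewrite !inE; apply/negbTE/negP => /andP[/dis/negP].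
by rewrite card_Fp // !card_codom // card_ord; lia.
Qed.

(** * The nonnegative rationals as a model of both equations *)

Section NonnegRational.
Local Open Scope ring_scope.

Definition nnegrat : Type := {q : rat | 0 <= q}.

Lemma invq_ge0 (q : rat) : 0 <= q -> 0 <= q^-1.
Proof. by rewrite invr_ge0. Qed.

(** The inverse of 0 is 0 by the convention of [rat], so the two inverse axioms also hold at 0. *)
Definition nnegrat_algebra : algebra :=
  @Algebra nnegrat (exist _ 0 (lexx 0)) (exist _ 1 ler01)
    (fun q r => exist _ (sval q + sval r) (addr_ge0 (svalP q) (svalP r)))
    (fun q r => exist _ (sval q * sval r) (mulr_ge0 (svalP q) (svalP r)))
    (fun q => exist _ (sval q)^-1 (invq_ge0 (svalP q))).

Lemma nnegrat_E_iamdz : satisfies nnegrat_algebra E_iamdz.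
Proof.
move=> _ [[[[[[[[->|->]|->]|->]|->]|->]|->]|->]|->] env; apply: val_inj => /=.
- by rewrite addrA.
- by rewrite addrC.
- by rewrite addr0.
- by rewrite mulrA.
- by rewrite mulrC.
- by rewrite mulr1.
- by rewrite mulrDr.
- by rewrite invrK.
have [->|q_neq0] := eqVneq (sval (env 0%N)) 0; first by rewrite mul0r.
by rewrite mulfV // mulr1.
Qed.

Lemma nnegrat_sum_squares (env : nat -> nnegrat_algebra) :
  eval env ((1 + x ^ 2 + y ^ 2) * (1 + x ^ 2 + y ^ 2)^-1)%term
    = eval env 1%term.
Proof.
apply: val_inj => /=; rewrite !mul1r -!expr2 mulfV //.
by rewrite gt_eqF // -addrA ltr_pwDl ?addr_ge0 ?sqr_ge0.
Qed.

Lemma nnegrat_mul_add (env : nat -> nnegrat_algebra) :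
  eval env ((x * (x + y)) * (x * (x + y))^-1)%term = eval env (x * x^-1)%term.
Proof.
apply: val_inj => /=.
have := svalP (env 0%N); have := svalP (env 1%N).
move: (sval (env 0%N)) (sval (env 1%N)) => q r r_ge0.
(* For x = 0 both sides are 0. Otherwise x + y > 0 because y is nonnegative; with negatives, y = -x
   would be a counterexample. *)
rewrite le_eqVlt => /predU1P[<-|q_gt0]; first by rewrite !mul0r.
by rewrite !mulfV // ?gt_eqF // mulr_gt0 // ltr_pwDl.
Qed.

End NonnegRational.

(** * Calculus of numerals and inverses in a model of the axioms *)

Section Numerals.
Variables (A : algebra) (A_E : satisfies A E_iamdz).

Local Notation "0" := (azero A).
Local Notation "1" := (aone A).
Local Infix "+" := (@aadd A).
Local Infix "*" := (@amul A).
Local Notation "a ^-1" := (@ainv A a).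

Let env (a b c : A) (n : nat) : A :=
  match n with 0%N => a | 1%N => b | _ => c end.

Lemma aaddA (a b c : A) : a + b + c = a + (b + c).
Proof.
(* [E_iamdz] is a left-nested union: the tactic descends to the left until the right member is the
   wanted equation. *)
by apply: (A_E (e := (x + y) + z ≈ x + (y + z)) _ (env a b c)); do ?[by []|by right|left].
Qed.

Lemma aaddC (a b : A) : a + b = b + a.
Proof.
by apply: (A_E (e := x + y ≈ y + x) _ (env a b a)); do ?[by []|by right|left].
Qed.

Lemma aaddr0 (a : A) : a + 0 = a.
Proof.
by apply: (A_E (e := x + 0 ≈ x) _ (env a a a)); do ?[by []|by right|left].
Qed.

Lemma amulA (a b c : A) : a * b * c = a * (b * c).
Proof.
by apply: (A_E (e := (x * y) * z ≈ x * (y * z)) _ (env a b c)); do ?[by []|by right|left].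
Qed.

Lemma amulC (a b : A) : a * b = b * a.
Proof.
by apply: (A_E (e := x * y ≈ y * x) _ (env a b a)); do ?[by []|by right|left].
Qed.

Lemma amulr1 (a : A) : a * 1 = a.
Proof.
by apply: (A_E (e := x * 1 ≈ x) _ (env a a a)); do ?[by []|by right|left].
Qed.

Lemma amulDr (a b c : A) : a * (b + c) = a * b + a * c.
Proof.
by apply: (A_E (e := x * (y + z) ≈ x * y + x * z) _ (env a b c)); do ?[by []|by right|left].
Qed.

Lemma ainvK (a : A) : a^-1^-1 = a.
Proof.
by apply: (A_E (e := (x^-1)^-1 ≈ x) _ (env a a a)); do ?[by []|by right|left].
Qed.

Lemma amulKV (a : A) : a * (a * a^-1) = a.
Proof.
by apply: (A_E (e := x * (x * x^-1) ≈ x) _ (env a a a)); do ?[by []|by right|left].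
Qed.

Lemma amulAC (a b c : A) : a * b * c = a * c * b.
Proof. by rewrite !amulA [b * c]amulC. Qed.

Lemma amulACA (a b c d : A) : (a * b) * (c * d) = (a * c) * (b * d).
Proof. by rewrite -!amulA [a * b * c]amulAC. Qed.

Lemma amulDl (a b c : A) : (b + c) * a = b * a + c * a.
Proof. by rewrite !(amulC _ a) amulDr. Qed.

(* The law 0 * a = 0 is not among the axioms; it is derived only for numerals. *)
Lemma a0mul0 : 0 * 0 = 0.
Proof. by rewrite -[LHS]aaddr0 -[X in _ + X]amulr1 -amulDr aaddC aaddr0 amulr1. Qed.

(** Regrouping [0 * 0 * 0^-1] gives [0 * 0^-1 = 0]; the last axiom, taken at [0^-1], then collapses
    [0^-1] to 0. *)
Lemma ainv0 : 0^-1 = 0.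
Proof.
have e : 0 * 0^-1 = 0 by rewrite -{1}a0mul0 amulA amulKV.
by rewrite -[LHS]amulKV ainvK (amulC 0^-1 0) e amulC e.
Qed.

Lemma aunit1 : 1 * 1^-1 = 1.
Proof. by rewrite -[LHS]amulr1 amulC amulKV. Qed.

(** The weak inverse law suffices: u u^-1 = u u^-1 (u v) = u v = 1, and then u^-1 = u^-1 (u v) =
    v. *)
Lemma ainv_unique (u v : A) : u * v = 1 -> u^-1 = v.
Proof.
move=> uv; have uV : u * u^-1 = 1.
  by rewrite -[LHS]amulr1 -[X in _ * X]uv -amulA (amulC (u * u^-1)) amulKV.
by rewrite -[LHS]amulr1 -uv -amulA (amulC u^-1) uV amulC amulr1.
Qed.

(** The candidate inverse of u is v (u v)^-1. *)
Lemma aunit_factor (u v : A) : (u * v) * (u * v)^-1 = 1 -> u * u^-1 = 1.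
Proof. by rewrite amulA => e; rewrite (ainv_unique e). Qed.

Lemma ainvM (u v : A) :
  u * u^-1 = 1 -> v * v^-1 = 1 -> (u * v)^-1 = u^-1 * v^-1.
Proof. by move=> uV vV; apply: ainv_unique; rewrite amulACA uV vV amulr1. Qed.

Fixpoint numeral (n : nat) : A := if n is m.+1 then numeral m + 1 else 0.

Lemma numeral1 : numeral 1 = 1.
Proof. by rewrite /= aaddC aaddr0. Qed.

Lemma numeralD (m n : nat) : numeral (m + n) = numeral m + numeral n.
Proof. by elim: n => [|n IH]; rewrite ?addn0 ?aaddr0 // addnS /= IH aaddA. Qed.

Lemma a0mul_numeral (n : nat) : 0 * numeral n = 0.
Proof. by elim: n => [|n IH] /=; rewrite ?a0mul0 // amulDr IH amulr1 aaddr0. Qed.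

Lemma numeralM (m n : nat) : numeral (m * n) = numeral m * numeral n.
Proof.
elim: m => [|m IH]; first by rewrite mul0n /= a0mul_numeral.
by rewrite mulSn addnC numeralD /= amulDl IH (amulC 1) amulr1.
Qed.

(** Strong induction, splitting off the smallest prime divisor. *)
Lemma numeral_unit_primes :
  (forall p, prime p -> numeral p * (numeral p)^-1 = 1) ->
  forall n : nat, (0 < n)%N -> numeral n * (numeral n)^-1 = 1.
Proof.
move=> prime_unit; elim/ltn_ind => n IH n_gt0.
have [n_le1|n_gt1] := leqP n 1.
  have -> : n = 1%N by lia.
  by rewrite numeral1 aunit1.
have p_pr := pdiv_prime n_gt1; have p_gt1 := prime_gt1 p_pr.
have [m_lt m_gt0] : (n %/ pdiv n < n)%N /\ (0 < n %/ pdiv n)%N.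
  by rewrite ltn_Pdiv // divn_gt0 ?pdiv_gt0 ?pdiv_leq.
rewrite -(divnK (pdiv_dvd n)) numeralM.
have := IH _ m_lt m_gt0; have := prime_unit _ p_pr.
by move=> uV vV; rewrite ainvM // amulACA uV vV amulr1.
Qed.

Lemma numeral_unit_sum_squares :
  satisfies A
    [set (1 + x ^ 2 + y ^ 2) * (1 + x ^ 2 + y ^ 2)^-1 ≈ 1] ->
  forall n : nat, (0 < n)%N -> numeral n * (numeral n)^-1 = 1.
Proof.
move=> A_sq; apply: numeral_unit_primes => p p_pr.
have [a [b /dvdnP[k]]] := prime_dvdn_1_sqr_sqr p_pr; rewrite mulnC => e.
(* It suffices to invert the numeral of p k = 1 + a^2 + b^2, which is the equation at the numerals
   of a and b. *)
apply: (@aunit_factor _ (numeral k)); rewrite -numeralM -e.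
rewrite !numeralD numeral1 -!mulnn !numeralM.
have /= := A_sq _ erefl (env (numeral a) (numeral b) 0).
(* [tpow] unfolds a square to [1 * a * a]; the leading units are removed. *)
by rewrite !(amulC 1) !amulr1.
Qed.

Lemma numeral_unit_mul_add :
  satisfies A [set (x * (x + y)) * (x * (x + y))^-1 ≈ x * x^-1] ->
  forall n : nat, (0 < n)%N -> numeral n * (numeral n)^-1 = 1.
Proof.
move=> A_ma [//|n] _; have /= := A_ma _ erefl (env 1 (numeral n) 0).
by rewrite aunit1 (amulC 1) amulr1 aaddC.
Qed.

(** * Fractions of numerals and the map from the nonnegative rationals *)

Hypothesis numeral_unit :
  forall n : nat, (0 < n)%N -> numeral n * (numeral n)^-1 = 1.

Definition afrac (m n : nat) : A := numeral m * (numeral n)^-1.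

(** Replacing 0 by [0 * numeral n] lets the numeral cancel with its inverse. *)
Lemma a0frac (n : nat) : (0 < n)%N -> afrac 0 n = 0.
Proof.
by move=> /numeral_unit nV; rewrite /afrac -[numeral 0](a0mul_numeral n)
  amulA nV amulr1.
Qed.

Lemma numeralV_mul (m n : nat) : (0 < m)%N -> (0 < n)%N ->
  (numeral (m * n))^-1 = (numeral m)^-1 * (numeral n)^-1.
Proof. by move=> m0 n0; rewrite numeralM ainvM ?numeral_unit. Qed.

Lemma afrac_reduce (k m n : nat) : (0 < k)%N -> (0 < n)%N ->
  afrac (m * k) (n * k) = afrac m n.
Proof.
by move=> k0 n0; rewrite /afrac numeralV_mul // numeralM amulACA
  (numeral_unit k0) amulr1.
Qed.

(** Both fractions are extended to the common denominator n n'. *)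
Lemma eq_afrac (m n m' n' : nat) : (0 < n)%N -> (0 < n')%N ->
  (m * n' = m' * n)%N -> afrac m n = afrac m' n'.
Proof.
move=> n0 n0' e.
by rewrite -(afrac_reduce m n0' n0) -(afrac_reduce m' n0 n0') e (mulnC n).
Qed.

Lemma afracD (m n m' n' : nat) : (0 < n)%N -> (0 < n')%N ->
  afrac m n + afrac m' n' = afrac (m * n' + m' * n) (n * n').
Proof.
move=> n0 n0'; rewrite -(afrac_reduce m n0' n0) -(afrac_reduce m' n0 n0').
by rewrite (mulnC n' n) /afrac -amulDl numeralD.
Qed.

Lemma afracM (m n m' n' : nat) : (0 < n)%N -> (0 < n')%N ->
  afrac m n * afrac m' n' = afrac (m * m') (n * n').
Proof. by move=> n0 n0'; rewrite /afrac amulACA numeralM numeralV_mul. Qed.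

Lemma afracV (m n : nat) : (0 < m)%N -> (0 < n)%N ->
  (afrac m n)^-1 = afrac n m.
Proof.
move=> m0 n0; apply: ainv_unique.
by rewrite /afrac (amulC (numeral n)) amulACA numeral_unit // (amulC _ (numeral n))
  numeral_unit // amulr1.
Qed.

Definition of_nnegrat (q : nnegrat) : A :=
  afrac `|numq (sval q)|%N `|denq (sval q)|%N.

(** This frees later computations from lowest terms. Cross multiplication in [rat] descends to
    naturals, as the absolute values change nothing when q is nonnegative. *)
Lemma of_nnegratE (q : nnegrat) (m n : nat) :
  (0 < n)%N -> sval q = (m%:R / n%:R)%R -> of_nnegrat q = afrac m n.
Proof.
case: q => q q_ge0 /= n_gt0 qE; have den_gt0 := denq_gt0 q.
apply: eq_afrac => //=; first by lia.
have num_ge0 : (0 <= numq q)%R by rewrite numq_ge0.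
have n_neq0 : (n%:R != 0 :> rat)%R by rewrite pnatr_eq0 -lt0n.
have : ((numq q)%:~R * n%:R = m%:R * (denq q)%:~R :> rat)%R.
  by rewrite numqE {1}qE mulrAC divfK.
rewrite !pmulrn -!intrM => /eqP; rewrite eqr_int => /eqP.
lia.
Qed.

Lemma nnegrat_frac (q : nnegrat) :
  exists m n : nat, (0 < n)%N /\ sval q = (m%:R / n%:R)%R.
Proof.
exists `|numq (sval q)|%N, `|denq (sval q)|%N.
split; first by have := denq_gt0 (sval q); lia.
rewrite -[LHS]divq_num_den !pmulrn !gez0_abs ?denq_ge0 // numq_ge0.
exact: svalP q.
Qed.

Lemma of_nnegrat_homomorphism : @homomorphism nnegrat_algebra A of_nnegrat.
Proof.
have natr_neq0 (n : nat) : (0 < n)%N -> (n%:R != 0 :> rat)%R.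
  by rewrite pnatr_eq0 -lt0n.
split=> [||q r|q r|q].
- by rewrite (@of_nnegratE _ 0 1) ?a0frac //= mul0r.
- by rewrite (@of_nnegratE _ 1 1) ?divr1 // /afrac numeral_unit.
- have [m [n [n0 qE]]] := nnegrat_frac q.
  have [m' [n' [n0' rE]]] := nnegrat_frac r.
  rewrite (of_nnegratE n0 qE) (of_nnegratE n0' rE) afracD //.
  apply: of_nnegratE; rewrite ?muln_gt0 ?n0 //= qE rE.
  by rewrite addf_div ?natr_neq0 // natrD !natrM.
- have [m [n [n0 qE]]] := nnegrat_frac q.
  have [m' [n' [n0' rE]]] := nnegrat_frac r.
  rewrite (of_nnegratE n0 qE) (of_nnegratE n0' rE) afracM //.
  by apply: of_nnegratE; rewrite ?muln_gt0 ?n0 //= qE rE mulf_div !natrM.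
have [m [n [n0 qE]]] := nnegrat_frac q; rewrite (of_nnegratE n0 qE).
(* [afracV] needs m > 0; for m = 0 both inverses are 0, by [ainv0] and by the convention of
   [rat]. *)
case: (posnP m) qE => [->|m0] qE.
  by rewrite a0frac // ainv0 (@of_nnegratE _ 0 1) ?a0frac //= qE !mul0r invr0.
by rewrite afracV //; apply: of_nnegratE; rewrite //= qE invf_div.
Qed.

End Numerals.

(** * Homomorphisms between initial algebras *)

Lemma homomorphism_id (A : algebra) : homomorphism (@id A).
Proof. by []. Qed.

Lemma homomorphism_comp (A B C : algebra) (f : A -> B) (g : B -> C) :
  homomorphism f -> homomorphism g -> homomorphism (g \o f).
Proof.
move=> [f0 f1 fD fM fV] [g0 g1 gD gM gV].
by split=> [||a b|a b|a] /=; rewrite ?f0 ?f1 ?fD ?fM ?fV.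
Qed.

Lemma initial_hom_unique (E : set equation) (A B : algebra) (f g : A -> B) :
  is_initial E A -> satisfies B E ->
  homomorphism f -> homomorphism g -> f =1 g.
Proof.
by move=> [_ A_init] /A_init[h _ h_unique] /h_unique fh /h_unique gh a; rewrite fh gh.
Qed.

(** The equation sets may differ, since uniqueness is applied only to the two composites, each from
    an initial algebra to itself. *)
Lemma initial_isomorphic (E E' : set equation) (A A' : algebra)
    (f : A -> A') (g : A' -> A) :
  is_initial E A -> is_initial E' A' ->
  homomorphism f -> homomorphism g -> isomorphic A A'.
Proof.
move=> A_init A'_init f_hom g_hom; exists f => //; exists g.
  apply: (initial_hom_unique A_init A_init.1 _ (homomorphism_id A)).
  exact: homomorphism_comp f_hom g_hom.
apply: (initial_hom_unique A'_init A'_init.1 _ (homomorphism_id A')).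
exact: homomorphism_comp g_hom f_hom.
Qed.

Lemma satisfiesU (A : algebra) (E E' : set equation) :
  satisfies A (E `|` E') <-> satisfies A E /\ satisfies A E'.
Proof.
split=> [AE|[AE AE'] e [/AE|/AE']//].
by split=> e Ee; apply: AE; [left|right].
Qed.

Theorem theorem4 (Q0ia I : algebra)
    (hQ0ia : is_initial
       (E_iamdz `|`
        [set (1 + x ^ 2 + y ^ 2) * (1 + x ^ 2 + y ^ 2)^-1 ≈ 1]) Q0ia)
    (hI : is_initial
       (E_iamdz `|`
        [set (x * (x + y)) * (x * (x + y))^-1 ≈ x * x^-1]) I) :
  isomorphic Q0ia I.
Proof.
have /satisfiesU[Q_E Q_sq] := hQ0ia.1.
have /satisfiesU[I_E I_ma] := hI.1.
have [f f_hom _] : exists2 f : Q0ia -> nnegrat_algebra, homomorphism f &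
    forall g, homomorphism g -> g =1 f.
  apply: hQ0ia.2; apply/satisfiesU; split; first exact: nnegrat_E_iamdz.
  by move=> _ -> env; exact: nnegrat_sum_squares.
have [g g_hom _] : exists2 g : I -> nnegrat_algebra, homomorphism g &
    forall h, homomorphism h -> h =1 g.
  apply: hI.2; apply/satisfiesU; split; first exact: nnegrat_E_iamdz.
  by move=> _ -> env; exact: nnegrat_mul_add.
(* Each map back from the rationals uses the extra equation of its target: first that of [I], then
   that of [Q0ia]. *)
apply: (initial_isomorphic hQ0ia hI).
  apply: homomorphism_comp f_hom (of_nnegrat_homomorphism I_E _).
  exact: numeral_unit_mul_add.
apply: homomorphism_comp g_hom (of_nnegrat_homomorphism Q_E _).
exact: numeral_unit_sum_squares.
Qed.
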